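(* Let $\mathcal{A}$ be an abelian category with enough projectives, let $\mathcal{B}$ be an abelian category with enough injectives, and let $\mathrm{F}\colon\mathcal{A}\rightleftarrows\mathcal{B}\colon\mathrm{G}$ be an adjunction with $\mathrm{F}$ left adjoint of $\mathrm{G}$. Assume that $\mathrm{F}(A)=0$ implies $A=0$ (for any $A\in\mathcal{A}$). For any $X\in\mathsf{Fix}_0(\mathcal{A})$ and any integer $d\geq 0$, the equivalence $\mathrm{F}\colon\mathsf{Fix}_0(\mathcal{A})\rightleftarrows\mathsf{coFix}_0(\mathcal{B})\colon\mathrm{G}$ restricts to an equivalence $$\mathrm{F}\colon\ \mathsf{Fix}_0(\mathcal{A})\cap\mathsf{gen}^{\mathcal{A}}_d(X) \ \rightleftarrows\ \mathsf{coFix}_0(\mathcal{B})\cap\mathsf{gen}^{\mathcal{B}}_d(\mathrm{F}X)\ \colon\mathrm{G}.$$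
   Context: $\mathrm{L}_i\mathrm{F}$ and $\mathrm{R}^i\mathrm{G}$ denote the $i$-th left derived functor of $\mathrm{F}$ and the $i$-th right derived functor of $\mathrm{G}$; $\eta$ and $\varepsilon$ denote the unit and counit of $(\mathrm{F},\mathrm{G})$. $\mathsf{Fix}_0(\mathcal{A})$ is the full subcategory of $\mathcal{A}$ of objects $A$ such that $\mathrm{L}_i\mathrm{F}(A)=0$ for all $i>0$, $\mathrm{R}^i\mathrm{G}(\mathrm{F}(A))=0$ for all $i>0$, and $\eta_A\colon A\to\mathrm{G}\mathrm{F}(A)$ is an isomorphism. $\mathsf{coFix}_0(\mathcal{B})$ is the full subcategory of $\mathcal{B}$ of objects $B$ such that $\mathrm{R}^i\mathrm{G}(B)=0$ for all $i>0$, $\mathrm{L}_i\mathrm{F}(\mathrm{G}(B))=0$ for all $i>0$, and $\varepsilon_B\colon\mathrm{F}\mathrm{G}(B)\to B$ is an isomorphism. The functors $\mathrm{F}$ and $\mathrm{G}$ restrict to an adjoint equivalence between $\mathsf{Fix}_0(\mathcal{A})$ and $\mathsf{coFix}_0(\mathcal{B})$. For an object $X$ in an abelian category $\mathcal{C}$, $\mathrm{add}_{\mathcal{C}}(X)$ is the class of direct summands of finite direct sums of copies of $X$. For $d\geq 0$, $\mathsf{gen}^{\mathcal{C}}_d(X)$ is the full subcategory of objects $C\in\mathcal{C}$ for which there is an exact sequence $X_d\to\cdots\to X_0\to C\to 0$ with $X_0,\ldots,X_d\in\mathrm{add}_{\mathcal{C}}(X)$. *)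

(* Defs.v *)
(* MathComp: hom-sets are zmodTypes; [cid] (classical choice) is used to pick
   kernels, resolutions and so on from their mere existence. *)
From mathcomp Require Import all_boot all_order all_algebra.
From mathcomp Require Import boolp.

Set Implicit Arguments.
Unset Strict Implicit.
Unset Printing Implicit Defensive.

Import GRing.Theory.
Local Open Scope ring_scope.

Record preadditive : Type := Preadditive {
  ob :> Type;
  hom : ob -> ob -> zmodType;
  idm : forall X : ob, hom X X;
  comp : forall X Y Z : ob, hom Y Z -> hom X Y -> hom X Z;
  compA : forall (W X Y Z : ob) (h : hom Y Z) (g : hom X Y) (f : hom W X),
    comp h (comp g f) = comp (comp h g) f;
  comp1m : forall (X Y : ob) (f : hom X Y), comp (idm Y) f = f;
  compm1 : forall (X Y : ob) (f : hom X Y), comp f (idm X) = f;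
  compDl : forall (X Y Z : ob) (g g' : hom Y Z) (f : hom X Y),
    comp (g + g') f = comp g f + comp g' f;
  compDr : forall (X Y Z : ob) (g : hom Y Z) (f f' : hom X Y),
    comp g (f + f') = comp g f + comp g f' }.

Arguments idm {_} _.
Arguments comp {_ _ _ _} _ _.

Notation "g '\oc' f" := (comp g f) (at level 40, left associativity).

Definition is_mono (C : preadditive) (X Y : C) (f : hom X Y) : Prop :=
  forall (W : C) (u v : hom W X), f \oc u = f \oc v -> u = v.

Definition is_epi (C : preadditive) (X Y : C) (f : hom X Y) : Prop :=
  forall (Z : C) (u v : hom Y Z), u \oc f = v \oc f -> u = v.

Definition is_iso (C : preadditive) (X Y : C) (f : hom X Y) : Prop :=
  exists g : hom Y X, g \oc f = idm X /\ f \oc g = idm Y.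

Definition is_zero (C : preadditive) (Z : C) : Prop :=
  (forall (Y : C) (f : hom Z Y), f = 0) /\ (forall (Y : C) (f : hom Y Z), f = 0).

Definition is_kernel (C : preadditive) (K X Y : C) (f : hom X Y) (k : hom K X)
    : Prop :=
  f \oc k = 0 /\
  forall (W : C) (h : hom W X), f \oc h = 0 -> exists! l : hom W K, k \oc l = h.

Definition is_cokernel (C : preadditive) (X Y Q : C) (f : hom X Y) (q : hom Y Q)
    : Prop :=
  q \oc f = 0 /\
  forall (W : C) (h : hom Y W), h \oc f = 0 -> exists! l : hom Q W, l \oc q = h.

Definition is_biproduct (C : preadditive) (X1 X2 S : C)
    (i1 : hom X1 S) (i2 : hom X2 S) (p1 : hom S X1) (p2 : hom S X2) : Prop :=
  [/\ p1 \oc i1 = idm X1, p2 \oc i2 = idm X2, p1 \oc i2 = 0, p2 \oc i1 = 0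
    & i1 \oc p1 + i2 \oc p2 = idm S].

Record abelianCat : Type := Abelian {
  ab_cat :> preadditive;
  ab_zero : exists Z : ab_cat, is_zero Z;
  ab_biproduct : forall X1 X2 : ab_cat,
    exists (S : ab_cat) (i1 : hom X1 S) (i2 : hom X2 S)
           (p1 : hom S X1) (p2 : hom S X2), is_biproduct i1 i2 p1 p2;
  ab_kernel : forall (X Y : ab_cat) (f : hom X Y),
    exists (K : ab_cat) (k : hom K X), is_kernel f k;
  ab_cokernel : forall (X Y : ab_cat) (f : hom X Y),
    exists (Q : ab_cat) (q : hom Y Q), is_cokernel f q;
  ab_mono_normal : forall (X Y : ab_cat) (m : hom X Y), is_mono m ->
    exists (Z : ab_cat) (f : hom Y Z), is_kernel f m;
  ab_epi_normal : forall (X Y : ab_cat) (e : hom X Y), is_epi e ->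
    exists (W : ab_cat) (f : hom W X), is_cokernel f e }.

(* The image of f is the kernel of its cokernel. *)
Definition is_image (C : preadditive) (X Y I : C) (f : hom X Y) (m : hom I Y)
    : Prop :=
  exists (Q : C) (q : hom Y Q), is_cokernel f q /\ is_kernel q m.

(* Exactness of X -> Y -> Z at Y: Im f and Ker g are the same subobject. *)
Definition exact (C : preadditive) (X Y Z : C) (f : hom X Y) (g : hom Y Z)
    : Prop :=
  exists (K : C) (k : hom K Y), is_image f k /\ is_kernel g k.

Definition is_projective (C : preadditive) (P : C) : Prop :=
  forall (X Y : C) (e : hom X Y) (f : hom P Y), is_epi e ->
    exists g : hom P X, e \oc g = f.

Definition is_injective (C : preadditive) (I : C) : Prop :=
  forall (X Y : C) (m : hom X Y) (f : hom X I), is_mono m ->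
    exists g : hom Y I, g \oc m = f.

Definition enough_projectives (C : preadditive) : Prop :=
  forall X : C, exists (P : C) (e : hom P X), is_projective P /\ is_epi e.

Definition enough_injectives (C : preadditive) : Prop :=
  forall X : C, exists (I : C) (m : hom X I), is_injective I /\ is_mono m.

Record functor (C D : preadditive) : Type := Functor {
  fobj :> C -> D;
  fmap : forall X Y : C, hom X Y -> hom (fobj X) (fobj Y);
  fmap1 : forall X : C, fmap (idm X) = idm (fobj X);
  fmapM : forall (X Y Z : C) (g : hom Y Z) (f : hom X Y),
    fmap (g \oc f) = fmap g \oc fmap f }.

Arguments fmap {C D} f {X Y} _ : rename.

(* Functors are not assumed additive: adjoint functors between abelian categories
   are shown to be additive below. *)
Definition is_additive (C D : preadditive) (F : functor C D) : Prop :=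
  forall (X Y : C) (f g : hom X Y), fmap F (f + g) = fmap F f + fmap F g.

(* F is left adjoint to G. *)
Record adjunction (C D : preadditive) (F : functor C D) (G : functor D C)
    : Type := Adjunction {
  adj_unit : forall X : C, hom X (G (F X));
  adj_counit : forall Y : D, hom (F (G Y)) Y;
  unit_nat : forall (X X' : C) (f : hom X X'),
    fmap G (fmap F f) \oc adj_unit X = adj_unit X' \oc f;
  counit_nat : forall (Y Y' : D) (g : hom Y Y'),
    g \oc adj_counit Y = adj_counit Y' \oc fmap F (fmap G g);
  triangleF : forall X : C, adj_counit (F X) \oc fmap F (adj_unit X) = idm (F X);
  triangleG : forall Y : D, fmap G (adj_counit Y) \oc adj_unit (G Y) = idm (G Y) }.

Arguments adj_unit {C D F G} a X : rename.
Arguments adj_counit {C D F G} a Y : rename.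

Definition is_adjoint_equivalence (C D : preadditive) (F : functor C D)
    (G : functor D C) (adj : adjunction F G) : Prop :=
  (forall X : C, is_iso (adj_unit adj X)) /\
  (forall Y : D, is_iso (adj_counit adj Y)).

Definition full_subcategory (C : preadditive) (P : C -> Prop) : preadditive :=
  @Preadditive {X : C | P X}
    (fun X Y => hom (sval X) (sval Y))
    (fun X => idm (sval X))
    (fun _ _ _ g f => g \oc f)
    (fun _ _ _ _ h g f => compA h g f)
    (fun _ _ f => comp1m f)
    (fun _ _ f => compm1 f)
    (fun _ _ _ g g' f => compDl g g' f)
    (fun _ _ _ g f f' => compDr g f f').

Definition restrict_functor (C D : preadditive) (F : functor C D)
    (P : C -> Prop) (Q : D -> Prop) (FP : forall X, P X -> Q (F X))
    : functor (full_subcategory P) (full_subcategory Q) :=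
  @Functor (full_subcategory P) (full_subcategory Q)
    (fun X => exist Q (F (sval X)) (FP _ (svalP X)))
    (fun _ _ f => fmap F f)
    (fun X => fmap1 F (sval X))
    (fun _ _ _ g f => fmapM F g f).

Definition restrict_adjunction (C D : preadditive) (F : functor C D)
    (G : functor D C) (adj : adjunction F G) (P : C -> Prop) (Q : D -> Prop)
    (FP : forall X, P X -> Q (F X)) (GQ : forall Y, Q Y -> P (G Y))
    : adjunction (restrict_functor FP) (restrict_functor GQ) :=
  @Adjunction (full_subcategory P) (full_subcategory Q)
    (restrict_functor FP) (restrict_functor GQ)
    (fun X => adj_unit adj (sval X))
    (fun Y => adj_counit adj (sval Y))
    (fun _ _ f => unit_nat adj f)
    (fun _ _ g => counit_nat adj g)
    (fun X => triangleF adj (sval X))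
    (fun Y => triangleG adj (sval Y)).

Definition restricts_to_equivalence (C D : preadditive) (F : functor C D)
    (G : functor D C) (adj : adjunction F G) (P : C -> Prop) (Q : D -> Prop)
    : Prop :=
  exists (FP : forall X, P X -> Q (F X)) (GQ : forall Y, Q Y -> P (G Y)),
    is_adjoint_equivalence (restrict_adjunction adj FP GQ).

Lemma comp0m (C : preadditive) (X Y Z : C) (f : hom X Y) :
  (0 : hom Y Z) \oc f = 0.
Proof. by apply: (addrI (0 \oc f)); rewrite -compDl !addr0. Qed.

Lemma compm0 (C : preadditive) (X Y Z : C) (g : hom Y Z) :
  g \oc (0 : hom X Y) = 0.
Proof. by apply: (addrI (g \oc 0)); rewrite -compDr !addr0. Qed.

Lemma fmap0 (C D : preadditive) (F : functor C D) :
  is_additive F -> forall X Y : C, fmap F (0 : hom X Y) = 0.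
Proof. by move=> aF X Y; apply: (addrI (fmap F 0)); rewrite -aF !addr0. Qed.

Lemma adjoint_eqF (C D : preadditive) (F : functor C D) (G : functor D C)
    (adj : adjunction F G) (X : C) (Y : D) (u v : hom (F X) Y) :
  fmap G u \oc adj_unit adj X = fmap G v \oc adj_unit adj X -> u = v.
Proof.
have key w : w = adj_counit adj Y \oc fmap F (fmap G w \oc adj_unit adj X).
  by rewrite fmapM compA -counit_nat -compA triangleF compm1.
by move=> e; rewrite (key u) (key v) e.
Qed.

Lemma adjoint_eqG (C D : preadditive) (F : functor C D) (G : functor D C)
    (adj : adjunction F G) (X : C) (Y : D) (u v : hom X (G Y)) :
  adj_counit adj Y \oc fmap F u = adj_counit adj Y \oc fmap F v -> u = v.
Proof.
have key w : w = fmap G (adj_counit adj Y \oc fmap F w) \oc adj_unit adj X.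
  by rewrite fmapM -compA unit_nat compA triangleG comp1m.
by move=> e; rewrite (key u) (key v) e.
Qed.

Lemma left_adjoint_additive (A : abelianCat) (D : preadditive) (F : functor A D)
    (G : functor D A) (adj : adjunction F G) : is_additive F.
Proof.
have F0 (X Y : A) : fmap F (0 : hom X Y) = 0.
  have [Z [Zi Zt]] := ab_zero A.
  rewrite -(comp0m Y (0 : hom X Z)) fmapM.
  suff -> : fmap F (0 : hom Z Y) = 0 by rewrite comp0m.
  by apply: (adjoint_eqF (adj := adj)); rewrite [LHS]Zi [RHS]Zi.
move=> X Y f g.
have [S [i1 [i2 [p1 [p2 [e11 e22 e12 e21 eS]]]]]] := ab_biproduct X X.
have FS : fmap F i1 \oc fmap F p1 + fmap F i2 \oc fmap F p2 = idm (F S).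
  have ext (u v : hom (F S) (F S)) :
      u \oc fmap F i1 = v \oc fmap F i1 -> u \oc fmap F i2 = v \oc fmap F i2 ->
      u = v.
    move=> e1 e2; apply: (adjoint_eqF (adj := adj)).
    rewrite -[LHS]compm1 -[RHS]compm1 -eS !compDr !compA -!(compA _ (adj_unit _ _)).
    by rewrite -!unit_nat !compA -!fmapM e1 e2.
  by apply: ext; rewrite compDl comp1m -!compA -!fmapM
    ?e11 ?e22 ?e12 ?e21 compm0 compm1 F0 ?addr0 ?add0r.
have -> : f + g = (f \oc p1 + g \oc p2) \oc (i1 + i2).
  rewrite compDl !compDr -!compA e11 e22 e12 e21 !compm0 !compm1.
  by rewrite addr0 add0r.
rewrite fmapM -[fmap F (i1 + i2)]comp1m -FS compDl compDr -!compA -!fmapM.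
rewrite (compDr p1) (compDr p2) e11 e22 e12 e21 addr0 add0r !compm1 !compDl.
by rewrite -!compA e11 e22 e12 e21 !compm0 !compm1 addr0 add0r.
Qed.

Lemma right_adjoint_additive (A : abelianCat) (D : preadditive) (F : functor A D)
    (G : functor D A) (adj : adjunction F G) : is_additive G.
Proof.
have aF := left_adjoint_additive adj.
move=> X Y f g; apply: (adjoint_eqG (adj := adj)).
by rewrite aF compDr -!counit_nat compDl.
Qed.

Definition zero_ob (A : abelianCat) : A := sval (cid (ab_zero A)).

Definition kernel_ob (A : abelianCat) (X Y : A) (f : hom X Y) : A :=
  sval (cid (ab_kernel f)).

Definition kernel_map (A : abelianCat) (X Y : A) (f : hom X Y)
    : hom (kernel_ob f) X := sval (cid (svalP (cid (ab_kernel f)))).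

Lemma kernel_mapP (A : abelianCat) (X Y : A) (f : hom X Y) :
  is_kernel f (kernel_map f).
Proof. exact: (svalP (cid (svalP (cid (ab_kernel f))))). Qed.

Definition cokernel_ob (A : abelianCat) (X Y : A) (f : hom X Y) : A :=
  sval (cid (ab_cokernel f)).

Definition cokernel_map (A : abelianCat) (X Y : A) (f : hom X Y)
    : hom Y (cokernel_ob f) := sval (cid (svalP (cid (ab_cokernel f)))).

Lemma cokernel_mapP (A : abelianCat) (X Y : A) (f : hom X Y) :
  is_cokernel f (cokernel_map f).
Proof. exact: (svalP (cid (svalP (cid (ab_cokernel f))))). Qed.

Lemma kernel_lift_ex (A : abelianCat) (X Y Z : A) (f : hom X Y) (g : hom Y Z) :
  g \oc f = 0 -> exists l : hom X (kernel_ob g), kernel_map g \oc l = f.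
Proof. by move=> gf0; have [l []] := (kernel_mapP g).2 _ _ gf0; exists l. Qed.

Definition kernel_lift (A : abelianCat) (X Y Z : A) (f : hom X Y) (g : hom Y Z)
    (gf0 : g \oc f = 0) : hom X (kernel_ob g) := sval (cid (kernel_lift_ex gf0)).

(* The homology Ker g / Im f of X -> Y -> Z at Y. *)
Definition homology (A : abelianCat) (X Y Z : A) (f : hom X Y) (g : hom Y Z)
    (gf0 : g \oc f = 0) : A := cokernel_ob (kernel_lift gf0).

Lemma exact_comp0 (C : preadditive) (X Y Z : C) (f : hom X Y) (g : hom Y Z) :
  exact f g -> g \oc f = 0.
Proof.
case=> K [k [[Q [q [[qf0 _] [_ kU]]]] [gk0 _]]].
by have [l [<- _]] := kU _ _ qf0; rewrite compA gk0 comp0m.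
Qed.

Lemma fmap_comp0 (C D : preadditive) (F : functor C D) (aF : is_additive F)
    (X Y Z : C) (f : hom X Y) (g : hom Y Z) :
  exact f g -> fmap F g \oc fmap F f = 0.
Proof. by move=> /exact_comp0 gf0; rewrite -fmapM gf0 fmap0. Qed.

Record proj_resolution (C : preadditive) (X : C) : Type := ProjResolution {
  pr_ob : nat -> C;
  pr_d : forall n, hom (pr_ob n.+1) (pr_ob n);
  pr_aug : hom (pr_ob 0) X;
  pr_proj : forall n, is_projective (pr_ob n);
  pr_aug_epi : is_epi pr_aug;
  pr_exact0 : exact (pr_d 0) pr_aug;
  pr_exact : forall n, exact (pr_d n.+1) (pr_d n) }.

Record inj_resolution (C : preadditive) (X : C) : Type := InjResolution {
  ir_ob : nat -> C;
  ir_d : forall n, hom (ir_ob n) (ir_ob n.+1);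
  ir_aug : hom X (ir_ob 0);
  ir_inj : forall n, is_injective (ir_ob n);
  ir_aug_mono : is_mono ir_aug;
  ir_exact0 : exact ir_aug (ir_d 0);
  ir_exact : forall n, exact (ir_d n) (ir_d n.+1) }.

Lemma kernel_mono (C : preadditive) (K X Y : C) (f : hom X Y) (k : hom K X) :
  is_kernel f k -> is_mono k.
Proof.
move=> [fk0 kU] W u v e.
have fku0 : f \oc (k \oc u) = 0 by rewrite compA fk0 comp0m.
by have [l [_ lU]] := kU _ _ fku0; rewrite -(lU u erefl) -(lU v (esym e)).
Qed.

Lemma cokernel_epi (C : preadditive) (X Y Q : C) (f : hom X Y) (q : hom Y Q) :
  is_cokernel f q -> is_epi q.
Proof.
move=> [qf0 qU] W u v e.
have uqf0 : (u \oc q) \oc f = 0 by rewrite -compA qf0 compm0.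
by have [l [_ lU]] := qU _ _ uqf0; rewrite -(lU u erefl) -(lU v (esym e)).
Qed.

Lemma exact_kernel_epi (A : abelianCat) (P K X Y : A) (g : hom X Y) (k : hom K X)
    (p : hom P K) : is_kernel g k -> is_epi p -> exact (k \oc p) g.
Proof.
move=> kerk epip; exists K, k; split=> //.
have [Z [f [fk0 kU]]] := ab_mono_normal (kernel_mono kerk).
have [qk0 qU] := cokernel_mapP k.
exists _, (cokernel_map k); split; split=> //.
- by rewrite compA qk0 comp0m.
- move=> W h hkp0; apply: qU; apply: epip.
  by rewrite comp0m -compA.
- move=> W h qh0; apply: kU.
  by have [l [<- _]] := qU _ _ fk0; rewrite -compA qh0 compm0.
Qed.

Lemma exact_cokernel_mono (A : abelianCat) (X Y Q I : A) (f : hom X Y)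
    (q : hom Y Q) (m : hom Q I) : is_cokernel f q -> is_mono m -> exact f (m \oc q).
Proof.
move=> cokq monom; exists _, (kernel_map q).
have [qk0 kU] := kernel_mapP q.
split; first by exists _, q.
split; first by rewrite -compA qk0 compm0.
move=> W h mqh0; apply: kU; apply: monom.
by rewrite compm0 compA.
Qed.

Lemma proj_resolution_ex (A : abelianCat) (X : A) :
  enough_projectives A -> inhabited (proj_resolution X).
Proof.
move=> /= enough.
pose P Y : A := sval (cid (enough Y)).
pose e Y : hom (P Y) Y := sval (cid (svalP (cid (enough Y)))).
have [projP epie] : (forall Y, is_projective (P Y)) /\ (forall Y, is_epi (e Y)).
  by split=> Y; have [] := svalP (cid (svalP (cid (enough Y)))).
pose d0 (Y Z : A) (g : hom Y Z) := kernel_map g \oc e (kernel_ob g).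
pose step (s : {Y : A & {Z : A & hom (P Y) Z}}) : {Y : A & {Z : A & hom (P Y) Z}} :=
  let g := tagged (tagged s) in
  existT (fun Y => {Z : A & hom (P Y) Z}) _ (existT (fun Z : A => hom _ Z) _ (d0 _ _ g)).
pose st n := iter n step
  (existT (fun Y => {Z : A & hom (P Y) Z}) X (existT (fun Z : A => hom _ Z) X (e X))).
have ex (Y Z : A) (g : hom Y Z) : exact (d0 _ _ g) g.
  exact: exact_kernel_epi (kernel_mapP g) (epie _).
constructor.
exact: (@ProjResolution A X (fun n => P (tag (st n)))
  (fun n => tagged (tagged (st n.+1))) (e X) (fun n => projP _) (epie X)
  (ex _ _ _) (fun n => ex _ _ _)).
Qed.

Lemma inj_resolution_ex (A : abelianCat) (X : A) :
  enough_injectives A -> inhabited (inj_resolution X).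
Proof.
move=> /= enough.
pose I Y : A := sval (cid (enough Y)).
pose m Y : hom Y (I Y) := sval (cid (svalP (cid (enough Y)))).
have [injI monom] : (forall Y, is_injective (I Y)) /\ (forall Y, is_mono (m Y)).
  by split=> Y; have [] := svalP (cid (svalP (cid (enough Y)))).
pose d0 (Y Z : A) (g : hom Y Z) := m (cokernel_ob g) \oc cokernel_map g.
pose step (s : {Z : A & {Y : A & hom Y (I Z)}}) : {Z : A & {Y : A & hom Y (I Z)}} :=
  let g := tagged (tagged s) in
  existT (fun Z => {Y : A & hom Y (I Z)}) _ (existT (fun Y : A => hom Y _) _ (d0 _ _ g)).
pose st n := iter n step
  (existT (fun Z => {Y : A & hom Y (I Z)}) X (existT (fun Y : A => hom Y _) X (m X))).
have ex (Y Z : A) (g : hom Y Z) : exact g (d0 _ _ g).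
  exact: exact_cokernel_mono (cokernel_mapP g) (monom _).
constructor.
exact: (@InjResolution A X (fun n => I (tag (st n)))
  (fun n => tagged (tagged (st n.+1))) (m X) (fun n => injI _) (monom X)
  (ex _ _ _) (fun n => ex _ _ _)).
Qed.

Definition proj_res (A : abelianCat) (enough : enough_projectives A) (X : A)
    : proj_resolution X :=
  sval (cid (let: inhabits r := proj_resolution_ex X enough in
             ex_intro (fun _ => True) r Logic.I)).

Definition inj_res (A : abelianCat) (enough : enough_injectives A) (X : A)
    : inj_resolution X :=
  sval (cid (let: inhabits r := inj_resolution_ex X enough in
             ex_intro (fun _ => True) r Logic.I)).

(* L_n F (X) is the n-th homology object of the complex
   ... -> F P_1 -> F P_0 -> 0; the action of L_n F on morphisms is not needed. *)
Definition left_derived (A B : abelianCat) (enough : enough_projectives A)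
    (F : functor A B) (aF : is_additive F) (n : nat) (X : A) : B :=
  let P := proj_res enough X in
  match n with
  | 0%N => homology (comp0m (zero_ob B) (fmap F (pr_d P 0)))
  | m.+1 => homology (fmap_comp0 aF (pr_exact P m))
  end.

(* R^n G (Y) is the n-th cohomology object of 0 -> G I^0 -> G I^1 -> ... *)
Definition right_derived (B A : abelianCat) (enough : enough_injectives B)
    (G : functor B A) (aG : is_additive G) (n : nat) (Y : B) : A :=
  let I := inj_res enough Y in
  match n with
  | 0%N => homology (compm0 (zero_ob A) (fmap G (ir_d I 0)))
  | m.+1 => homology (fmap_comp0 aG (ir_exact I m))
  end.

Definition Fix0 (A B : abelianCat) (enoughA : enough_projectives A)
    (enoughB : enough_injectives B) (F : functor A B) (G : functor B A)
    (adj : adjunction F G) (X : A) : Prop :=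
  let L := left_derived enoughA (left_adjoint_additive adj) in
  let R := right_derived enoughB (right_adjoint_additive adj) in
  [/\ forall i, (0 < i)%N -> is_zero (L i X),
      forall i, (0 < i)%N -> is_zero (R i (F X))
    & is_iso (adj_unit adj X)].

Definition coFix0 (A B : abelianCat) (enoughA : enough_projectives A)
    (enoughB : enough_injectives B) (F : functor A B) (G : functor B A)
    (adj : adjunction F G) (Y : B) : Prop :=
  let L := left_derived enoughA (left_adjoint_additive adj) in
  let R := right_derived enoughB (right_adjoint_additive adj) in
  [/\ forall i, (0 < i)%N -> is_zero (R i Y),
      forall i, (0 < i)%N -> is_zero (L i (G Y))
    & is_iso (adj_counit adj Y)].

(* S, with injections i_k and projections p_k, is the direct sum of n copies of
   X. *)
Definition is_power (C : preadditive) (X : C) (n : nat) (S : C)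
    (i : 'I_n -> hom X S) (p : 'I_n -> hom S X) : Prop :=
  (forall j k, p j \oc i k = if j == k then idm X else 0) /\
  \sum_(k < n) (i k \oc p k) = idm S.

Definition in_add (C : preadditive) (X Y : C) : Prop :=
  exists (n : nat) (S : C) (i : 'I_n -> hom X S) (p : 'I_n -> hom S X),
    is_power i p /\
    exists (Y' : C) (i1 : hom Y S) (i2 : hom Y' S)
           (p1 : hom S Y) (p2 : hom S Y'), is_biproduct i1 i2 p1 p2.

(* The sequence X_d -> ... -> X_0 -> Y -> 0 is given by total families indexed
   by nat, of which only X_0, ..., X_d and the maps between them matter. *)
Definition gen (C : preadditive) (d : nat) (X Y : C) : Prop :=
  exists (X_ : nat -> C) (f : forall n, hom (X_ n.+1) (X_ n)) (e : hom (X_ 0%N) Y),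
    [/\ forall n, (n <= d)%N -> in_add X (X_ n),
        is_epi e,
        (0 < d)%N -> exact (f 0%N) e
      & forall n, (n.+1 < d)%N -> exact (f n.+1) (f n)].

(* Main.v *)
(* If L_i F vanishes on Y and on add X for i > 0, dimension shifting along a
   sequence X_d -> ... -> X_0 -> Y -> 0 shows that its syzygies are F-acyclic too,
   so F keeps the sequence exact. Conversely, given Y_d -> ... -> Y_0 -> Y -> 0
   with Y_n in add (F X), apply G: the cokernel of G Y_0 -> G Y is killed by F,
   hence zero, and as G Y is F-acyclic, F preserves the kernel G K of G Y_0 -> G Y,
   K being the kernel of Y_0 -> Y. Therefore F G K = K and G K is F-acyclic, and
   one continues with K in place of Y.

   The vanishing of L_i F is expressed independently of resolutions, by F keeping
   kernels of epimorphisms onto the object monic, and R^i G is treated as a left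
   derived functor on the opposite categories. *)
From mathcomp Require Import all_boot all_order all_algebra.
Require Import Defs.

Set Implicit Arguments.
Unset Strict Implicit.
Unset Printing Implicit Defensive.

Import GRing.Theory.
Local Open Scope ring_scope.

(** * Monomorphisms, epimorphisms, kernels and isomorphisms in a preadditive category *)

Section Preadditive.
Variable C : preadditive.
Implicit Types W X Y Z : C.

Lemma compNm X Y Z (g : hom Y Z) (f : hom X Y) : (- g) \oc f = - (g \oc f).
Proof. by apply: (addrI (g \oc f)); rewrite -compDl !subrr comp0m. Qed.

Lemma compmN X Y Z (g : hom Y Z) (f : hom X Y) : g \oc (- f) = - (g \oc f).
Proof. by apply: (addrI (g \oc f)); rewrite -compDr !subrr compm0. Qed.

Lemma comp_suml (I : finType) X Y Z (g : I -> hom Y Z) (f : hom X Y) :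
  (\sum_i g i) \oc f = \sum_i (g i \oc f).
Proof.
by apply: (big_morph (fun g => g \oc f)) => [u v|]; rewrite ?compDl ?comp0m.
Qed.

Lemma comp_sumr (I : finType) X Y Z (g : hom Y Z) (f : I -> hom X Y) :
  g \oc (\sum_i f i) = \sum_i (g \oc f i).
Proof.
by apply: (big_morph (fun f => g \oc f)) => [u v|]; rewrite ?compDr ?compm0.
Qed.

Lemma monoP X Y (f : hom X Y) :
  (forall W (h : hom W X), f \oc h = 0 -> h = 0) -> is_mono f.
Proof.
move=> f0 W u v e; apply/eqP; rewrite -subr_eq0; apply/eqP/f0.
by rewrite compDr compmN e subrr.
Qed.

Lemma epiP X Y (f : hom X Y) :
  (forall W (h : hom Y W), h \oc f = 0 -> h = 0) -> is_epi f.
Proof.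
move=> f0 W u v e; apply/eqP; rewrite -subr_eq0; apply/eqP/f0.
by rewrite compDl compNm e subrr.
Qed.

Lemma mono_eq0 W X Y (f : hom X Y) (h : hom W X) :
  is_mono f -> f \oc h = 0 -> h = 0.
Proof. by move=> mf e; apply: mf; rewrite e compm0. Qed.

Lemma epi_eq0 X Y Z (f : hom X Y) (h : hom Y Z) :
  is_epi f -> h \oc f = 0 -> h = 0.
Proof. by move=> ef e; apply: ef; rewrite e comp0m. Qed.

Lemma mono_comp X Y Z (g : hom Y Z) (f : hom X Y) :
  is_mono g -> is_mono f -> is_mono (g \oc f).
Proof. by move=> mg mf W u v e; apply/mf/mg; rewrite !compA. Qed.

Lemma mono_cancel X Y Z (g : hom Y Z) (f : hom X Y) :
  is_mono (g \oc f) -> is_mono f.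
Proof. by move=> m W u v e; apply: m; rewrite -!compA e. Qed.

Lemma epi_comp X Y Z (g : hom Y Z) (f : hom X Y) :
  is_epi g -> is_epi f -> is_epi (g \oc f).
Proof. by move=> eg ef W u v e; apply/eg/ef; rewrite -!compA. Qed.

Lemma epi_cancel X Y Z (g : hom Y Z) (f : hom X Y) :
  is_epi (g \oc f) -> is_epi g.
Proof. by move=> m W u v e; apply: m; rewrite !compA e. Qed.

Lemma retraction_mono X Y (f : hom X Y) (g : hom Y X) :
  g \oc f = idm X -> is_mono f.
Proof.
move=> gf; apply: (@mono_cancel _ _ _ g); rewrite gf => W u v.
by rewrite !comp1m.
Qed.

Lemma section_epi X Y (f : hom X Y) (g : hom Y X) :
  f \oc g = idm Y -> is_epi f.
Proof.
move=> fg; apply: (@epi_cancel _ _ _ _ g); rewrite fg => W u v.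
by rewrite !compm1.
Qed.

Lemma kernel_ex K W X Y (f : hom X Y) (k : hom K X) (h : hom W X) :
  is_kernel f k -> f \oc h = 0 -> exists l, k \oc l = h.
Proof. by case=> _ /(_ W h) kU /kU [l [e _]]; exists l. Qed.

Lemma cokernel_ex Q W X Y (f : hom X Y) (q : hom Y Q) (h : hom Y W) :
  is_cokernel f q -> h \oc f = 0 -> exists l, l \oc q = h.
Proof. by case=> _ /(_ W h) kU /kU [l [e _]]; exists l. Qed.

Lemma kernelP K X Y (f : hom X Y) (k : hom K X) :
  f \oc k = 0 -> is_mono k ->
  (forall W (h : hom W X), f \oc h = 0 -> exists l, k \oc l = h) -> is_kernel f k.
Proof.
move=> fk mk kU; split=> // W h /kU [l e]; exists l; split=> // l' e'.
by apply: mk; rewrite e e'.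
Qed.

Lemma cokernelP Q X Y (f : hom X Y) (q : hom Y Q) :
  q \oc f = 0 -> is_epi q ->
  (forall W (h : hom Y W), h \oc f = 0 -> exists l, l \oc q = h) ->
  is_cokernel f q.
Proof.
move=> fk mk kU; split=> // W h /kU [l e]; exists l; split=> // l' e'.
by apply: mk; rewrite e e'.
Qed.

Lemma biproduct_swap X1 X2 S (i1 : hom X1 S) (i2 : hom X2 S)
    (p1 : hom S X1) (p2 : hom S X2) :
  is_biproduct i1 i2 p1 p2 -> is_biproduct i2 i1 p2 p1.
Proof. by case=> *; split=> //; rewrite addrC. Qed.

Lemma biproduct_kernel X1 X2 S (i1 : hom X1 S) (i2 : hom X2 S)
    (p1 : hom S X1) (p2 : hom S X2) :
  is_biproduct i1 i2 p1 p2 -> is_kernel p2 i1.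
Proof.
case=> e11 e22 e12 e21 e; apply: kernelP => //; first exact: retraction_mono e11.
move=> W h h0; exists (p1 \oc h).
by rewrite -[RHS]comp1m -e compDl -!compA h0 compm0 addr0.
Qed.

Lemma iso_inv X Y (f : hom X Y) : is_iso f -> exists g : hom Y X, is_iso g.
Proof. by case=> g [gf fg]; exists g, f. Qed.

Lemma iso_retraction X Y (f : hom X Y) (g : hom Y X) :
  is_iso f -> g \oc f = idm X -> is_iso g.
Proof.
case=> f' [f'f ff'] gf; exists f; split=> //.
by rewrite -[g]compm1 -ff' (compA g) gf comp1m.
Qed.

Lemma iso_section X Y (f : hom X Y) (g : hom Y X) :
  is_iso f -> f \oc g = idm Y -> is_iso g.
Proof.
case=> f' [f'f ff'] fg; exists f; split=> //.
by rewrite -[g]comp1m -f'f -(compA f') fg compm1.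
Qed.

Lemma iso_mono X Y (f : hom X Y) : is_iso f -> is_mono f.
Proof. by case=> g [gf _]; exact: retraction_mono gf. Qed.

Lemma iso_epi X Y (f : hom X Y) : is_iso f -> is_epi f.
Proof. by case=> g [_ fg]; exact: section_epi fg. Qed.

End Preadditive.

(** * Opposite categories and duality of exactness *)

Definition op (C : preadditive) : preadditive :=
  @Preadditive C (fun X Y => hom Y X) (fun X => idm X)
    (fun _ _ _ g f => f \oc g)
    (fun _ _ _ _ h g f => esym (compA f g h))
    (fun _ _ f => compm1 f) (fun _ _ f => comp1m f)
    (fun _ _ _ g g' f => compDr f g g') (fun _ _ _ g f f' => compDl f f' g).

Definition op_functor (C D : preadditive) (F : functor C D) :
    functor (op C) (op D) :=
  @Functor (op C) (op D) F (fun X Y f => @fmap C D F Y X f) (fun X => fmap1 F X)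
    (fun _ _ _ g f => fmapM F f g).

Definition op_abelian (C : abelianCat) : abelianCat.
Proof.
apply: (@Abelian (op C)).
- by have [Z [Zi Zt]] := ab_zero C; exists Z.
- move=> X1 X2; have [S [i1 [i2 [p1 [p2 [e11 e22 e12 e21 e]]]]]] := ab_biproduct X1 X2.
  by exists S, p1, p2, i1, i2.
- by move=> X Y f; exact: (@ab_cokernel C Y X f).
- by move=> X Y f; exact: (@ab_kernel C Y X f).
- by move=> X Y f; exact: (@ab_epi_normal C Y X f).
- by move=> X Y f; exact: (@ab_mono_normal C Y X f).
(* Kept transparent, so that objects and morphisms of the opposite category convert to those of
   [C]. *)
Defined.

(** The definition of [exact] is not visibly self-dual: dually, the cokernel [q] of [f] has to be a
    cokernel of [k] as well. It is one because [f] factors through [k]. *)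
Lemma exact_op (C : preadditive) (X Y Z : C) (f : hom X Y) (g : hom Y Z) :
  exact f g -> @exact (op C) Z Y X g f.
Proof.
case=> K [k [[Q [q [cq kq]]] kg]].
have [p kp] := kernel_ex kq cq.1.
have cqk : is_cokernel k q.
  apply: (cokernelP kq.1 (cokernel_epi cq)) => W h hk.
  by apply: (cokernel_ex cq); rewrite -kp compA hk comp0m.
by exists Q, q; split=> //; exists K, k.
Qed.

(** * Diagram chasing in an abelian category *)

Section Abelian.
Variable C : abelianCat.
Implicit Types W X Y Z : C.

(** By normality [e] is the cokernel of some [f]; since [f] factors through [k], a map that kills
    [k] also kills [f]. *)
Lemma epi_cokernel K X Y (e : hom X Y) (k : hom K X) :
  is_epi e -> is_kernel e k -> is_cokernel k e.
Proof.
move=> ee kk; apply: (cokernelP kk.1 ee) => W h hk.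
have [V [f ce]] := ab_epi_normal ee.
have [l fE] := kernel_ex kk ce.1.
by apply: (cokernel_ex ce); rewrite -fE compA hk comp0m.
Qed.

(* Pullbacks of epimorphisms are epimorphisms, so generalised elements can be
   lifted along [e] after passing to a cover. *)
Lemma epi_lift W X Y (e : hom X Y) (h : hom W Y) :
  is_epi e -> exists V (c : hom V W) (l : hom V X), is_epi c /\ e \oc l = h \oc c.
Proof.
move=> ee.
have [S [i1 [i2 [p1 [p2 [e11 e22 e12 e21 eS]]]]]] := ab_biproduct X W.
(* The pullback of [e] and [h] is the kernel of [g]. As [g] is epi, it is the cokernel of [k], so a
   map [u] killing [p2 \oc k] satisfies [u \oc p2 = w \oc g]; restricting to the two summands gives
   [w = 0], then [u = 0]. *)
pose g := e \oc p1 - h \oc p2.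
have gi1 : g \oc i1 = e by rewrite compDl compNm -!compA e11 e21 compm0 compm1 subr0.
have eg : is_epi g by apply: (@epi_cancel _ _ _ _ _ i1); rewrite gi1.
have [K [k kk]] := ab_kernel g.
exists K, (p2 \oc k), (p1 \oc k); split; last first.
  by apply/eqP; rewrite -subr_eq0 !compA -compNm -compDl kk.1.
apply: epiP => V u; rewrite compA => up2k.
have [w wg] := cokernel_ex (epi_cokernel eg kk) up2k.
have w0 : w = 0.
  by apply: (epi_eq0 ee); rewrite -gi1 compA wg -compA e21 compm0.
by rewrite -[u]compm1 -e22 compA -wg w0 !comp0m.
Qed.

Lemma epi_coverP X Y (e : hom X Y) :
  (forall W (h : hom W Y), exists V (c : hom V W) (l : hom V X),
     is_epi c /\ e \oc l = h \oc c) -> is_epi e.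
Proof.
move=> /(_ Y (idm Y)) [V [c [l [ec el]]]].
by apply: (@epi_cancel _ _ _ _ _ l); rewrite el comp1m.
Qed.

(** Let [m] be the image of [p]. The subobject [k \oc m] is the kernel of some [t], which kills [f]
    and so factors through the cokernel [q] of [f]. Since [q] kills [k], so does [t]; hence [k]
    factors through [k \oc m], and the cokernel [c] of [p] is zero. *)
Lemma exact_image K X Y Z (f : hom X Y) (g : hom Y Z) (k : hom K Y) :
  exact f g -> is_kernel g k -> exists2 p : hom X K, is_epi p & k \oc p = f.
Proof.
move=> ex kg; have [p kp] := kernel_ex kg (exact_comp0 ex); exists p => //.
case: ex => K' [k' [[Q [q [cq kq]]] kg']].
have [D [c cc]] := ab_cokernel p.
have [N [m km]] := ab_kernel c.
have [p' mp] := kernel_ex km cc.1.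
have [V [t kt]] := ab_mono_normal (mono_comp (kernel_mono kg) (kernel_mono km)).
have [s sq] : exists s, s \oc q = t.
  by apply: (cokernel_ex cq); rewrite -kp -mp (compA k) compA kt.1 comp0m.
have qk : q \oc k = 0.
  by have [u <-] := kernel_ex kg' kg.1; rewrite compA kq.1 comp0m.
have [l kml] : exists l, (k \oc m) \oc l = k.
  by apply: (kernel_ex kt); rewrite -sq -compA qk compm0.
have ml : m \oc l = idm K by apply: (kernel_mono kg); rewrite compA kml compm1.
have c0 : c = 0 by rewrite -[c]compm1 -ml compA km.1 comp0m.
by apply: epiP => U u /(cokernel_ex cc) [v <-]; rewrite c0 compm0.
Qed.

Lemma exact_lift W X Y Z (f : hom X Y) (g : hom Y Z) (h : hom W Y) :
  exact f g -> g \oc h = 0 ->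
  exists V (c : hom V W) (l : hom V X), is_epi c /\ f \oc l = h \oc c.
Proof.
move=> ex gh; have [K [k kk]] := ab_kernel g.
have [p ep <-] := exact_image ex kk; have [h' <-] := kernel_ex kk gh.
have [V [c [l [ec pl]]]] := epi_lift h' ep.
by exists V, c, l; rewrite -!compA pl.
Qed.

Lemma exact_mono_comp X Y Z W (f : hom X Y) (g : hom Y Z) (m : hom Z W) :
  is_mono m -> exact f g <-> exact f (m \oc g).
Proof.
move=> mm.
have kE K (k : hom K Y) : is_kernel g k <-> is_kernel (m \oc g) k.
  split=> -[gk kU]; split.
  - by rewrite -compA gk compm0.
  - by move=> V h; rewrite -compA => /(mono_eq0 mm) /kU.
  - by apply: (mono_eq0 mm); rewrite compA.
  - by move=> V h gh; apply: kU; rewrite -compA gh compm0.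
by split=> -[K [k [ik /kE kk]]]; exists K, k.
Qed.

Lemma exact_epi_cokernel X Y Z (f : hom X Y) (g : hom Y Z) :
  exact f g -> is_epi g -> is_cokernel f g.
Proof.
move=> ex eg; have [K [k kk]] := ab_kernel g.
have [p ep kp] := exact_image ex kk.
apply: (cokernelP (exact_comp0 ex) eg) => W h hf.
apply: (cokernel_ex (epi_cokernel eg kk)); apply: (epi_eq0 ep).
by rewrite -compA kp.
Qed.

Lemma cokernel_exact X Y Z (f : hom X Y) (g : hom Y Z) :
  is_cokernel f g -> exact f g.
Proof.
move=> cg; rewrite -[g]comp1m; apply: (exact_cokernel_mono cg) => W u v.
by rewrite !comp1m.
Qed.

Lemma kernel_exact K X Y (f : hom X Y) (k : hom K X) : is_kernel f k -> exact k f.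
Proof.
move=> kk; rewrite -[k]compm1; apply: (exact_kernel_epi kk) => W u v.
by rewrite !compm1.
Qed.

Lemma exact_mono_kernel X Y Z (f : hom X Y) (g : hom Y Z) :
  exact f g -> is_mono f -> is_kernel g f.
Proof.
move=> ex mf; apply: (kernelP (exact_comp0 ex) mf) => W h gh.
have [V [c [l [ec fl]]]] := exact_lift ex gh.
have [K [k kk]] := ab_kernel c.
(* The lift [l] over the cover [c] kills the kernel of [c], because [f] is monic, and hence descends
   along [c]. *)
have [|l' lc] := cokernel_ex (h := l) (epi_cokernel ec kk).
  by apply: (mono_eq0 mf); rewrite compA fl -compA kk.1 compm0.
by exists l'; apply: ec; rewrite -fl -lc compA.
Qed.

Lemma zero_cokernel_epi X Y Q (f : hom X Y) (q : hom Y Q) :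
  is_cokernel f q -> (is_zero Q <-> is_epi f).
Proof.
move=> cq; split=> [[Q0 _]|ef].
  apply: epiP => W h /(cokernel_ex cq) [l <-].
  by rewrite [l]Q0 comp0m.
have q0 : q = 0 by apply: (epi_eq0 ef cq.1).
have Q1 : idm Q = 0 by apply: (cokernel_epi cq); rewrite comp0m q0 compm0.
by split=> W h; [rewrite -[h]compm1 Q1 compm0 | rewrite -[h]comp1m Q1 comp0m].
Qed.

Lemma zero_homology X Y Z (f : hom X Y) (g : hom Y Z) (gf0 : g \oc f = 0) :
  is_zero (homology gf0) <-> exact f g.
Proof.
have kl : kernel_map g \oc kernel_lift gf0 = f.
  by rewrite /kernel_lift; case: boolp.cid.
rewrite (zero_cokernel_epi (cokernel_mapP _)); split=> [el|ex].
  by rewrite -kl; apply: exact_kernel_epi (kernel_mapP g) el.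
have [p ep kp] := exact_image ex (kernel_mapP g).
have -> : kernel_lift gf0 = p by apply: (kernel_mono (kernel_mapP g)); rewrite kp.
exact: ep.
Qed.

(* As in Schanuel's lemma: a second presentation [e0] of [Y] exhibits [M] as the
   quotient of [K + P0] by [K0]. *)
Lemma presentation_compare K0 P0 K M Y S (k0 : hom K0 P0) (e0 : hom P0 Y)
    (k : hom K M) (e : hom M Y) (s : hom P0 M) (t : hom K0 K)
    (i1 : hom K S) (i2 : hom P0 S) (p1 : hom S K) (p2 : hom S P0) :
  is_kernel e0 k0 -> is_epi e0 -> is_kernel e k ->
  e \oc s = e0 -> k \oc t = s \oc k0 -> is_biproduct i1 i2 p1 p2 ->
  is_kernel (k \oc p1 + s \oc p2) (i1 \oc t - i2 \oc k0) /\
  is_epi (k \oc p1 + s \oc p2).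
Proof.
move=> kk0 ee0 kk es kt [e11 e22 e12 e21 eS].
have ext W (u v : hom W S) :
    p1 \oc u = p1 \oc v -> p2 \oc u = p2 \oc v -> u = v.
  move=> u1 u2; rewrite -[u]comp1m -[v]comp1m -eS !compDl -!compA.
  by rewrite u1 u2.
have w1 : p1 \oc (i1 \oc t - i2 \oc k0) = t.
  by rewrite compDr compmN !compA e11 e12 comp0m comp1m subr0.
have w2 : p2 \oc (i1 \oc t - i2 \oc k0) = - k0.
  by rewrite compDr compmN !compA e21 e22 comp0m comp1m sub0r.
split; first apply: kernelP.
- by rewrite compDl -!compA w1 w2 compmN kt subrr.
- apply: monoP => W h h0; apply: (mono_eq0 (kernel_mono kk0)).
  by apply: oppr_inj; rewrite -compNm -w2 -compA h0 compm0 oppr0.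
(* The second component of [h] lies in the kernel of [e0], so it is [k0 \oc l]; the sign in front of
   [i2 \oc k0] makes [- l] the required lift. *)
- move=> W h; rewrite compDl -!compA => gh.
  have : e0 \oc (p2 \oc h) = 0.
    rewrite -es -compA; move/(congr1 (fun u => e \oc u)): gh.
    by rewrite compDr compA kk.1 comp0m add0r compm0.
  move=> /(kernel_ex kk0) [l kl]; exists (- l); apply: ext; rewrite compA ?w1 ?w2.
    apply: (kernel_mono kk); rewrite compmN compmN compA kt -compA kl.
    by apply/eqP; rewrite eq_sym -addr_eq0; apply/eqP.
  by rewrite compNm compmN opprK.
- apply: epi_coverP => W m.
  (* After a cover, [m] differs from an element coming from [P0] by one of [K]. *)
  have [V [c [x [ec ex]]]] := epi_lift (e \oc m) ee0.
  have [|y ky] := kernel_ex (h := m \oc c - s \oc x) kk.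
    by rewrite compDr compmN !compA es ex subrr.
  exists V, c, (i1 \oc y + i2 \oc x); split=> //.
  rewrite compDl -!compA.
  have -> : p1 \oc (i1 \oc y + i2 \oc x) = y.
    by rewrite compDr !compA e11 e12 comp0m comp1m addr0.
  have -> : p2 \oc (i1 \oc y + i2 \oc x) = x.
    by rewrite compDr !compA e21 e22 comp0m comp1m add0r.
  by rewrite ky subrK.
Qed.

(** [N] is the preimage of the subobject [X] under [e1]. A cover [M] of the extension [Y] thus
    yields a cover [M] of [Z] with kernel [N], and a cover [N] of [X] with kernel [K]. *)
Lemma extension_kernel X Y Z K M (k : hom X Y) (e : hom Y Z)
    (k1 : hom K M) (e1 : hom M Y) :
  is_kernel e k -> is_kernel e1 k1 -> is_epi e1 ->
  exists N (n : hom N M) (j : hom K N) (q : hom N X),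
    [/\ is_kernel (e \oc e1) n, n \oc j = k1, is_kernel q j & is_epi q].
Proof.
move=> kk kk1 ee1; have [N [n kn]] := ab_kernel (e \oc e1).
have [q kq] : exists q, k \oc q = e1 \oc n.
  by apply: (kernel_ex kk); rewrite compA kn.1.
have [j nj] : exists j, n \oc j = k1.
  by apply: (kernel_ex kn); rewrite -compA kk1.1 compm0.
exists N, n, j, q; split=> //.
  apply: kernelP.
  - by apply: (mono_eq0 (kernel_mono kk)); rewrite compA kq -compA nj kk1.1.
  - by apply: (@mono_cancel _ _ _ _ n); rewrite nj; exact: kernel_mono kk1.
  - move=> W h qh; have : e1 \oc (n \oc h) = 0 by rewrite compA -kq -compA qh compm0.
    move=> /(kernel_ex kk1) [l kl]; exists l; apply: (kernel_mono kn).
    by rewrite compA nj.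
apply: epi_coverP => W a.
have [V [c [m [ec em]]]] := epi_lift (k \oc a) ee1.
have [|x nx] := kernel_ex (h := m) kn.
  by rewrite -compA em !compA kk.1 !comp0m.
exists V, c, x; split=> //; apply: (kernel_mono kk).
by rewrite !compA kq -compA nx em.
Qed.

End Abelian.

(** * Acyclic objects of a right exact functor *)

Definition right_exact (A B : abelianCat) (F : functor A B) : Prop :=
  is_additive F /\
  forall (X Y Q : A) (f : hom X Y) (q : hom Y Q),
    is_cokernel f q -> is_cokernel (fmap F f) (fmap F q).

Section Acyclic.
Variables (A B : abelianCat) (F : functor A B).
Hypothesis rF : right_exact F.
Implicit Types X Y Z K M P S : A.

Lemma right_exact_epi X Y (e : hom X Y) : is_epi e -> is_epi (fmap F e).
Proof.
move=> ee; have [K [k kk]] := ab_kernel e.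
exact: cokernel_epi (rF.2 _ _ _ _ _ (epi_cokernel ee kk)).
Qed.

Lemma right_exact_exact X Y Z (f : hom X Y) (g : hom Y Z) :
  exact f g -> is_epi g -> exact (fmap F f) (fmap F g).
Proof. by move=> ex eg; apply/cokernel_exact/rF.2/exact_epi_cokernel. Qed.

(* [L_1 F X = 0], phrased without a choice of projective presentation. *)
Definition acyclic1 X : Prop :=
  forall K M (k : hom K M) (e : hom M X),
    is_kernel e k -> is_epi e -> is_mono (fmap F k).

(* [L_i F X = 0] for [0 < i <= n], by dimension shifting. *)
Fixpoint acyclic_upto (n : nat) X : Prop :=
  if n is m.+1 then
    acyclic1 X /\
    forall K M (k : hom K M) (e : hom M X),
      is_kernel e k -> is_epi e -> acyclic_upto m M -> acyclic_upto m K
  else True.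

Definition acyclic X : Prop := forall n, acyclic_upto n X.

Lemma acyclic_kernel K M X (k : hom K M) (e : hom M X) :
  is_kernel e k -> is_epi e -> acyclic M -> acyclic X -> acyclic K.
Proof. by move=> kk ee aM aX n; have [_ h] := aX n.+1; exact: h kk ee (aM n). Qed.

Lemma acyclic_kernel_fmap K M X (k : hom K M) (e : hom M X) :
  is_kernel e k -> is_epi e -> acyclic X -> is_kernel (fmap F e) (fmap F k).
Proof.
move=> kk ee aX; apply: exact_mono_kernel.
  exact: right_exact_exact (kernel_exact kk) ee.
by have [h _] := aX 1%N; exact: h kk ee.
Qed.

Lemma acyclic_upto_iso n X Y (u : hom X Y) :
  is_iso u -> acyclic_upto n X -> acyclic_upto n Y.
Proof.
case: n => // n [v [vu uv]].
have red K M (k : hom K M) (e : hom M Y) :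
    is_kernel e k -> is_epi e -> is_kernel (v \oc e) k /\ is_epi (v \oc e).
  move=> [ek0 kU] ee; split; last by apply: epi_comp => //; exact: section_epi vu.
  split=> [|W h]; first by rewrite -compA ek0 compm0.
  by rewrite -compA => /(mono_eq0 (retraction_mono uv)) /kU.
case=> t h; split=> K M k e kk ee; have [kk' ee'] := red _ _ _ _ kk ee.
  exact: t kk' ee'.
exact: h kk' ee'.
Qed.

(** No induction on [n] is called for: with [N] from [extension_kernel], acyclicity passes from [M]
    to [N] because of [Z], and from [N] to [K] because of [X]. *)
Lemma acyclic_upto_extension n X Y Z (k : hom X Y) (e : hom Y Z) :
  is_kernel e k -> is_epi e -> acyclic_upto n X -> acyclic_upto n Z ->
  acyclic_upto n Y.
Proof.
case: n => // n kk ee [tX hX] [tZ hZ].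
split=> K M k1 e1 kk1 ee1;
  have [N [m [j [q [km mj kj eq]]]]] := extension_kernel kk kk1 ee1;
  have ez := epi_comp ee ee1.
  by rewrite -mj fmapM; apply: mono_comp; [exact: tZ km ez | exact: tX kj eq].
by move=> aM; apply: hX kj eq _; exact: hZ km ez aM.
Qed.

Lemma acyclic_upto_biproduct n X Y S (i1 : hom X S) (i2 : hom Y S)
    (p1 : hom S X) (p2 : hom S Y) :
  is_biproduct i1 i2 p1 p2 -> acyclic_upto n X -> acyclic_upto n Y ->
  acyclic_upto n S.
Proof.
move=> bS; apply: acyclic_upto_extension (biproduct_kernel bS) _.
by case: bS => _ e22 _ _ _; exact: section_epi e22.
Qed.

(** Adding [Y] to a cover [M] of [X] gives a cover of [S] with the same kernel. For this enlarged
    cover to be acyclic up to [n], it suffices that [Y] is, one degree below the conclusion. *)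
Lemma acyclic_upto_summand n X Y S (i1 : hom X S) (i2 : hom Y S)
    (p1 : hom S X) (p2 : hom S Y) :
  is_biproduct i1 i2 p1 p2 -> acyclic_upto n Y -> acyclic_upto n.+1 S ->
  acyclic_upto n.+1 X.
Proof.
move=> bS aY [tS hS].
have red K M (k : hom K M) (e : hom M X) : is_kernel e k -> is_epi e ->
    exists (T : A) (j1 : hom M T) (j2 : hom Y T) (q1 : hom T M) (q2 : hom T Y)
      (e' : hom T S),
    [/\ is_biproduct j1 j2 q1 q2, is_kernel e' (j1 \oc k) & is_epi e'].
  move=> kk ee; have [T [j1 [j2 [q1 [q2 bT]]]]] := ab_biproduct M Y.
  have [e11 e22 e12 e21 eS] := bS; have [f11 f22 f12 f21 eT] := bT.
  exists T, j1, j2, q1, q2, (i1 \oc e \oc q1 + i2 \oc q2); split=> //.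
    apply: kernelP.
    - rewrite compDl -!compA (compA q1) (compA q2) f11 f21 comp0m comp1m kk.1.
      by rewrite !compm0 addr0.
    - by apply: mono_comp (kernel_mono kk); exact: retraction_mono f11.
    - move=> W h; rewrite compDl -!compA => h0.
      have : e \oc (q1 \oc h) = 0.
        move/(congr1 (fun u => p1 \oc u)): h0.
        by rewrite compDr !(compA p1) e11 e12 comp0m comp1m addr0 compm0.
      move=> /(kernel_ex kk) [l kl]; exists l.
      have q2h : q2 \oc h = 0.
        move/(congr1 (fun u => p2 \oc u)): h0.
        by rewrite compDr !(compA p2) e21 e22 comp0m comp1m add0r compm0.
      by rewrite -compA kl -[RHS]comp1m -eT compDl -!compA q2h compm0 addr0.
  apply: epiP => W h; rewrite compDr => h0.
  have h1 : h \oc i1 = 0.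
    apply: (epi_eq0 ee); move/(congr1 (fun u => u \oc j1)): h0.
    by rewrite compDl -!compA f11 f21 !compm0 compm1 comp0m addr0.
  have h2 : h \oc i2 = 0.
    move/(congr1 (fun u => u \oc j2)): h0.
    by rewrite compDl -!compA f12 f22 !compm0 compm1 comp0m add0r.
  by rewrite -[h]compm1 -eS compDr !compA h1 h2 !comp0m addr0.
split=> K M k e kk ee;
  have [T [j1 [j2 [q1 [q2 [e' [bT kk' ee']]]]]]] := red _ _ _ _ kk ee.
  apply: (@mono_cancel _ _ _ _ (fmap F j1)); rewrite -fmapM.
  exact: tS kk' ee'.
move=> aM; apply: hS kk' ee' _.
exact: acyclic_upto_biproduct bT aM aY.
Qed.

Lemma acyclic_summand X Y S (i1 : hom X S) (i2 : hom Y S)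
    (p1 : hom S X) (p2 : hom S Y) :
  is_biproduct i1 i2 p1 p2 -> acyclic S -> acyclic X.
Proof.
(* [X] and [Y] are generalised so that the induction hypothesis also serves the complementary
   summand. *)
move=> bS aS n; elim: n X Y i1 i2 p1 p2 bS => // n IH X Y i1 i2 p1 p2 bS.
exact: acyclic_upto_summand bS (IH _ _ _ _ _ _ (biproduct_swap bS)) (aS n.+1).
Qed.

Lemma projective_section P M (e : hom M P) :
  is_projective P -> is_epi e -> exists s, e \oc s = idm P.
Proof. by move=> pP /(pP _ _ _ (idm P)). Qed.

Lemma split_kernel K M P (k : hom K M) (e : hom M P) (s : hom P M) :
  is_kernel e k -> e \oc s = idm P ->
  exists r : hom M K, is_biproduct k s r e.
Proof.
move=> kk es; have [|r kr] := kernel_ex (h := idm M - s \oc e) kk.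
  by rewrite compDr compmN compA es comp1m compm1 subrr.
have mk := kernel_mono kk; exists r; split=> //.
- by apply: mk; rewrite compA kr compDl compNm -compA kk.1 compm0 subr0 comp1m compm1.
- by apply: mk; rewrite compA kr compDl compNm -compA es compm1 comp1m subrr compm0.
- exact: kk.1.
- by rewrite kr subrK.
Qed.

(** A cover of a projective splits, making its kernel a summand with projective complement. The two
    claims are proved together, since each at [n.+1] uses the other at [n]. *)
Lemma projective_acyclic_upto n :
  (forall P, is_projective P -> acyclic_upto n P) /\
  (forall K P S (i1 : hom K S) (i2 : hom P S) (p1 : hom S K) (p2 : hom S P),
     is_projective P -> is_biproduct i1 i2 p1 p2 ->
     acyclic_upto n S -> acyclic_upto n K).
Proof.
elim: n => // n [IHp IHs]; split=> [P pP|K P S i1 i2 p1 p2 pP bS]; last first.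
  exact: acyclic_upto_summand bS (IHp _ pP).
have red K M (k : hom K M) (e : hom M P) : is_kernel e k -> is_epi e ->
    exists s r, is_biproduct k s r e.
  move=> kk ee; have [s es] := projective_section pP ee.
  by have [r b] := split_kernel kk es; exists s, r.
split=> K M k e kk ee; have [s [r b]] := red _ _ _ _ kk ee; last exact: IHs pP b.
by case: b => rk _ _ _ _; apply: (@retraction_mono _ _ _ _ (fmap F r));
  rewrite -fmapM rk fmap1.
Qed.

Lemma projective_acyclic P : is_projective P -> acyclic P.
Proof. by move=> pP n; have [h _] := projective_acyclic_upto n; exact: h. Qed.

Lemma presentation_lift K0 P K M X (k0 : hom K0 P) (e0 : hom P X)
    (k : hom K M) (e : hom M X) :
  is_projective P -> is_kernel e0 k0 -> is_kernel e k -> is_epi e ->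
  exists s t, e \oc s = e0 /\ k \oc t = s \oc k0.
Proof.
move=> pP kk0 kk ee; have [s es] := pP _ _ _ e0 ee.
have [|t kt] := kernel_ex (h := s \oc k0) kk; last by exists s, t.
by rewrite compA es kk0.1.
Qed.

(** A single projective presentation detects acyclicity in degree one. If [F k] kills [z], then by
    [presentation_compare] and right exactness [z], placed in the first summand, lifts after a cover
    to some [y] in [F K0]. Its component in [F P] is zero, so [F k0] kills [y], whence [y = 0] and
    [z = 0]. *)
Lemma projective_acyclic1 K0 P X (k0 : hom K0 P) (e0 : hom P X) :
  is_projective P -> is_kernel e0 k0 -> is_epi e0 -> is_mono (fmap F k0) ->
  acyclic1 X.
Proof.
move=> pP kk0 ee0 mk0 K M k e kk ee.
have [s [t [es kt]]] := presentation_lift pP kk0 kk ee.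
have [S [i1 [i2 [p1 [p2 bS]]]]] := ab_biproduct K P.
have [kg eg] := presentation_compare kk0 ee0 kk es kt bS.
have [e11 e22 e12 e21 eS] := bS.
apply: monoP => W z kz.
have [|V [c [y [ec ey]]]] := exact_lift (h := fmap F i1 \oc z)
  (right_exact_exact (kernel_exact kg) eg).
  by rewrite compA -fmapM compDl -!compA e11 e21 compm0 compm1 addr0.
have y0 : y = 0.
  apply: (mono_eq0 mk0).
  have w2 : (- p2) \oc (i1 \oc t - i2 \oc k0) = k0.
    by rewrite compDr compmN !compNm !compA e21 e22 comp0m comp1m oppr0 add0r opprK.
  rewrite -w2 fmapM -compA ey !compA -fmapM compNm e21 oppr0.
  by rewrite (fmap0 rF.1) !comp0m.
apply: (epi_eq0 ec); move/(congr1 (fun u => fmap F p1 \oc u)): ey.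
by rewrite y0 !compm0 !compA -fmapM e11 fmap1 comp1m => <-.
Qed.

(** * Acyclicity read off a projective resolution *)

Definition resolves (P : nat -> A) (d : forall n, hom (P n.+1) (P n)) X
    (e : hom (P 0%N) X) : Prop :=
  [/\ forall n, is_projective (P n), is_epi e, exact (d 0%N) e
    & forall n, exact (d n.+1) (d n)].

Lemma resolves_kernel (P : nat -> A) (d : forall n, hom (P n.+1) (P n)) X
    (e : hom (P 0%N) X) K (k : hom K (P 0%N)) :
  resolves d e -> is_kernel e k ->
  exists2 e', k \oc e' = d 0%N &
    resolves (P := fun n => P n.+1) (fun n => d n.+1) e'.
Proof.
case=> pP ee ex0 ex kk; have [e' ee' ke] := exact_image ex0 kk.
exists e' => //; split=> //.
by apply/(exact_mono_comp _ _ (kernel_mono kk)); rewrite ke.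
Qed.

(** Both directions are inductions in which the resolution varies: the syzygy of [X] is resolved by
    the shifted complex. *)
Lemma acyclic_resolution (P : nat -> A) (d : forall n, hom (P n.+1) (P n)) X
    (e : hom (P 0%N) X) : resolves d e ->
  acyclic X <-> forall n, exact (fmap F (d n.+1)) (fmap F (d n)).
Proof.
move=> rX; split=> [aX n|ex n].
  elim: n P d X e rX aX => [|n IH] P d X e rX aX;
    have [pP ee ex0 ex] := rX; have [K [k kk]] := ab_kernel e;
    have [e' ke rK] := resolves_kernel rX kk.
    rewrite -ke fmapM.
    apply/(exact_mono_comp _ _ (kernel_mono (acyclic_kernel_fmap kk ee aX))).
    by case: rK => _ ee' ex0' _; exact: right_exact_exact.
  apply: (IH _ (fun n => d n.+1) K e' rK).
  exact: acyclic_kernel kk ee (projective_acyclic (pP 0%N)) aX.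
elim: n P d X e rX ex => // n IH P d X e rX ex;
  have [pP ee _ _] := rX; have [K0 [k0 kk0]] := ab_kernel e;
  have [e' ke rK] := resolves_kernel rX kk0.
split.
  (* Exactness at [F P_1] makes [F k0] monic: an element killed by it lifts to [F P_1], there comes
     from [F P_2], and so maps to zero in the syzygy. *)
  apply: projective_acyclic1 (pP 0%N) kk0 ee _; apply: monoP => W z kz.
  have [_ ee' _ _] := rK.
  have [V [c [y [ec ey]]]] := epi_lift z (right_exact_epi ee').
  have [|V' [c' [x [ec' ex']]]] := exact_lift (h := y) (ex 0%N).
    by rewrite -ke fmapM -compA ey compA kz comp0m.
  apply: (epi_eq0 (epi_comp ec ec')); rewrite compA -ey -compA -ex' compA -fmapM.
  have -> : e' \oc d 1%N = 0 by case: rK => _ _ h _; exact: exact_comp0 h.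
  by rewrite (fmap0 rF.1) comp0m.
move=> K M k f kk ef aM.
have [s [t [es kt]]] := presentation_lift (pP 0%N) kk0 kk ef.
have [S [i1 [i2 [p1 [p2 bS]]]]] := ab_biproduct K (P 0%N).
have [kg eg] := presentation_compare kk0 ee kk es kt bS.
have [_ h] := projective_acyclic_upto n; apply: h (pP 0%N) bS _.
(* The sum of [K] and [P 0] is an extension of [M] by the syzygy [K0]; the projective summand is
   then cancelled. *)
apply: acyclic_upto_extension kg eg _ aM.
exact: (IH _ (fun n => d n.+1) K0 e' rK (fun n => ex n.+1)).
Qed.

Lemma zero_acyclic Z : is_zero Z -> acyclic Z.
Proof.
case=> Z0 _; apply: projective_acyclic => X Y e f _; exists 0.
by rewrite compm0 [RHS]Z0.
Qed.

End Acyclic.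

(** * Exactness of adjoint functors and vanishing of derived functors *)

Definition op_adjunction (C D : preadditive) (F : functor C D) (G : functor D C)
    (adj : adjunction F G) : adjunction (op_functor G) (op_functor F) :=
  @Adjunction (op D) (op C) (op_functor G) (op_functor F)
    (adj_counit adj) (adj_unit adj)
    (fun _ _ g => esym (counit_nat adj g)) (fun _ _ f => esym (unit_nat adj f))
    (triangleG adj) (triangleF adj).

Lemma left_adjoint_right_exact (A B : abelianCat) (F : functor A B)
    (G : functor B A) (adj : adjunction F G) : right_exact F.
Proof.
have aF := left_adjoint_additive adj; split=> // X Y Q f q cq.
apply: cokernelP.
- by rewrite -fmapM cq.1 (fmap0 aF).
- move=> W u v e; apply: (adjoint_eqF (adj := adj)); apply: (cokernel_epi cq).
  by rewrite -!compA -unit_nat !compA -!fmapM e.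
- move=> W h hf.
  (* The adjoint transpose of [h] factors through [q]; transposing the factor back gives the map
     wanted. *)
  have [|l lq] := cokernel_ex (h := fmap G h \oc adj_unit adj Y) cq.
    rewrite -compA -unit_nat compA -fmapM hf (fmap0 (right_adjoint_additive adj)).
    by rewrite comp0m.
  exists (adj_counit adj W \oc fmap F l).
  by rewrite -compA -fmapM lq fmapM compA -counit_nat -compA triangleF compm1.
Qed.

Definition op_left_exact (A B : abelianCat) (F : functor A B) (G : functor B A)
    (adj : adjunction F G) :
  @right_exact (op_abelian B) (op_abelian A) (op_functor G) :=
  @left_adjoint_right_exact (op_abelian B) (op_abelian A) _ _ (op_adjunction adj).

Lemma right_adjoint_kernel (A B : abelianCat) (F : functor A B)
    (G : functor B A) (adj : adjunction F G) (K X Y : B) (f : hom X Y)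
    (k : hom K X) : is_kernel f k -> is_kernel (fmap G f) (fmap G k).
Proof. by move=> kk; exact: (op_left_exact adj).2 kk. Qed.

(* [R^i G Y = 0] for all [i > 0]. *)
Definition coacyclic (A B : abelianCat) (G : functor B A) (Y : B) : Prop :=
  @acyclic (op_abelian B) (op_abelian A) (op_functor G) Y.

Lemma left_derived_zero (A B : abelianCat) (enough : enough_projectives A)
    (F : functor A B) (aF : is_additive F) (X : A) : right_exact F ->
  (forall i, (0 < i)%N -> is_zero (left_derived enough aF i X)) <-> acyclic F X.
Proof.
move=> rF; set P := proj_res enough X.
rewrite (acyclic_resolution rF (d := pr_d P) (e := pr_aug P)); last first.
  by split; [exact: pr_proj | exact: pr_aug_epi | exact: pr_exact0 | exact: pr_exact].
split=> [h n|h [//|n] _]; last exact/zero_homology.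
by have /zero_homology := h n.+1 isT.
Qed.

Lemma right_derived_zero (A B : abelianCat) (enough : enough_injectives B)
    (F : functor A B) (G : functor B A) (adj : adjunction F G)
    (aG : is_additive G) (Y : B) :
  (forall i, (0 < i)%N -> is_zero (right_derived enough aG i Y)) <-> coacyclic G Y.
Proof.
pose I := inj_res enough Y.
(* An injective resolution is a projective resolution in the opposite category. *)
have rI : @resolves (op_abelian B) (ir_ob I) (ir_d I) Y (ir_aug I).
  split; [move=> n U V e f|exact: (@ir_aug_mono _ _ I)|exact: exact_op (ir_exact0 I)|].
    exact: (@ir_inj _ _ I n V U e f).
  by move=> n; exact: exact_op (ir_exact I n).
have E := acyclic_resolution (op_left_exact adj) rI.
split=> [h|/E h [//|n] _].
  by apply/E => n; apply: exact_op; have /zero_homology := h n.+1 isT.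
by apply/zero_homology; exact: (exact_op (h n)).
Qed.

Lemma Fix0P (A B : abelianCat) (enoughA : enough_projectives A)
    (enoughB : enough_injectives B) (F : functor A B) (G : functor B A)
    (adj : adjunction F G) (X : A) :
  Fix0 enoughA enoughB adj X <->
  [/\ acyclic F X, coacyclic G (F X) & is_iso (adj_unit adj X)].
Proof.
have L := left_derived_zero enoughA (left_adjoint_additive adj) _
  (left_adjoint_right_exact adj).
have R := right_derived_zero enoughB adj (right_adjoint_additive adj).
by split=> -[/L h /R h' i].
Qed.

Lemma coFix0P (A B : abelianCat) (enoughA : enough_projectives A)
    (enoughB : enough_injectives B) (F : functor A B) (G : functor B A)
    (adj : adjunction F G) (Y : B) :
  coFix0 enoughA enoughB adj Y <->
  [/\ coacyclic G Y, acyclic F (G Y) & is_iso (adj_counit adj Y)].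
Proof.
have L := left_derived_zero enoughA (left_adjoint_additive adj) _
  (left_adjoint_right_exact adj).
have R := right_derived_zero enoughB adj (right_adjoint_additive adj).
by split=> -[/R h /L h' i].
Qed.

Lemma coacyclic_iso (A B : abelianCat) (G : functor B A) (X Y : B) (u : hom X Y) :
  is_iso u -> coacyclic G X -> coacyclic G Y.
Proof.
move=> [v [vu uv]] aX n; apply: (@acyclic_upto_iso (op_abelian B) _ _ _ _ _ v _ (aX n)).
by exists u.
Qed.

(** * Summands of finite powers *)

Lemma fmap_sum (C D : preadditive) (F : functor C D) (I : finType) (X Y : C)
    (f : I -> hom X Y) : is_additive F -> fmap F (\sum_i f i) = \sum_i fmap F (f i).
Proof.
by move=> aF; apply: (big_morph (fmap F)) => [u v|]; rewrite ?aF // fmap0.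
Qed.

Lemma fmap_iso (C D : preadditive) (F : functor C D) (X Y : C) (u : hom X Y) :
  is_iso u -> is_iso (fmap F u).
Proof. by case=> v [vu uv]; exists (fmap F v); rewrite -!fmapM vu uv !fmap1. Qed.

Lemma in_add_fmap (C D : preadditive) (F : functor C D) (X Y : C) :
  is_additive F -> in_add X Y -> in_add (F X) (F Y).
Proof.
move=> aF [n [S [i [p [[ip sp] [Y' [i1 [i2 [p1 [p2 [e11 e22 e12 e21 e]]]]]]]]]]].
exists n, (F S), (fun k => fmap F (i k)), (fun k => fmap F (p k)); split; first split.
- by move=> j k; rewrite -fmapM ip; case: eqP; rewrite ?fmap1 // fmap0.
- by under eq_bigr do rewrite -fmapM; rewrite -fmap_sum // sp fmap1.
exists (F Y'), (fmap F i1), (fmap F i2), (fmap F p1), (fmap F p2).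
by split; rewrite -?fmapM ?e11 ?e22 ?e12 ?e21 ?fmap1 ?fmap0 // -aF e fmap1.
Qed.

Lemma in_add_iso (C : preadditive) (X X' Y : C) (u : hom X X') :
  is_iso u -> in_add X Y -> in_add X' Y.
Proof.
move=> [v [vu uv]] [n [S [i [p [[ip sp] aY]]]]].
exists n, S, (fun k => i k \oc v), (fun k => u \oc p k); split; last exact: aY.
split=> [j k|].
  rewrite -compA (compA (p j)) ip; case: eqP => _; first by rewrite comp1m uv.
  by rewrite comp0m compm0.
by under eq_bigr do rewrite -compA (compA v) vu comp1m.
Qed.

(** This form of membership lets the invertibility of a natural transformation pass from [X] to
    [Y]. *)
Lemma in_add_sum (C : preadditive) (X Y : C) : in_add X Y ->
  exists n (a : 'I_n -> hom X Y) (b : 'I_n -> hom Y X), \sum_k (a k \oc b k) = idm Y.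
Proof.
move=> [n [S [i [p [[_ sp] [Y' [i1 [i2 [p1 [p2 [e11 _ _ _ _]]]]]]]]]]].
exists n, (fun k => p1 \oc i k), (fun k => p k \oc i1).
under eq_bigr do rewrite -compA (compA (i _)).
by rewrite -comp_sumr -comp_suml sp comp1m e11.
Qed.

(** The inverse at [Y] is the inverse [v] at [Z] carried along each [a k] and [b k] and summed;
    naturality of the counit does the rest. *)
Lemma counit_iso_add (C D : preadditive) (F : functor C D) (G : functor D C)
    (adj : adjunction F G) (Z Y : D) : is_additive F -> is_additive G ->
  is_iso (adj_counit adj Z) -> in_add Z Y -> is_iso (adj_counit adj Y).
Proof.
move=> aF aG [v [vu uv]] /in_add_sum [n [a [b ab]]].
exists (\sum_k (fmap F (fmap G (a k)) \oc v \oc b k)); split.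
  rewrite comp_suml.
  under eq_bigr do rewrite -compA counit_nat compA -(compA _ v) vu compm1 -!fmapM.
  by rewrite -!fmap_sum // ab !fmap1.
rewrite comp_sumr.
by under eq_bigr do rewrite !compA -counit_nat -(compA (a _)) uv compm1.
Qed.

Lemma power_acyclic (A B : abelianCat) (F : functor A B) (X : A) n (S : A)
    (i : 'I_n -> hom X S) (p : 'I_n -> hom S X) :
  right_exact F -> is_power i p -> acyclic F X -> acyclic F S.
Proof.
move=> rF ip aX; elim: n S i p ip => [|n IH] S i p [ip sp].
  apply: zero_acyclic; rewrite big_ord0 in sp.
  by split=> W h; [rewrite -[h]compm1 -sp compm0 | rewrite -[h]comp1m -sp comp0m].
(* The kernel of the first projection is a power with one factor fewer, and the whole power is an
   extension of [X] by it. *)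
have [K [k kk]] := ab_kernel (p ord0).
have /boolp.choice [j kj] : forall m, exists l, k \oc l = i (lift ord0 m).
  by move=> m; apply: (kernel_ex kk); rewrite ip.
have aK : acyclic F K.
  apply: (IH K j (fun m => p (lift ord0 m) \oc k)); split=> [l m|].
    by rewrite -compA kj ip (inj_eq lift_inj).
  apply: (kernel_mono kk); rewrite comp_sumr.
  under eq_bigr do rewrite !compA kj.
  rewrite -comp_suml; move: sp; rewrite big_ord_recl compm1.
  move/(congr1 (fun u => u \oc k)).
  by rewrite comp1m compDl -compA kk.1 compm0 add0r.
move=> m; apply: acyclic_upto_extension kk _ (aK m) (aX m).
by apply: (@section_epi _ _ _ _ (i ord0)); rewrite ip eqxx.
Qed.

Lemma in_add_acyclic (A B : abelianCat) (F : functor A B) (X Y : A) :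
  right_exact F -> in_add X Y -> acyclic F X -> acyclic F Y.
Proof.
move=> rF [n [S [i [p [ip [Y' [i1 [i2 [p1 [p2 bS]]]]]]]]]] aX.
exact: acyclic_summand bS (power_acyclic rF ip aX).
Qed.

(** * Finite presentations by summands of powers *)

Lemma gen0E (C : preadditive) (X Y : C) :
  gen 0 X Y <-> exists (X0 : C) (e : hom X0 Y), in_add X X0 /\ is_epi e.
Proof.
split=> [[X_ [f [e [aX ee _ _]]]]|[X0 [e [aX ee]]]].
  by exists (X_ 0%N), e; split=> //; exact: aX.
by exists (fun=> X0), (fun=> 0), e.
Qed.

(** The recursive form of [gen] behind the inductions on [d]: the syzygy [K] replaces [Y], with one
    term fewer. *)
Lemma genSE (C : abelianCat) d (X Y : C) :
  gen d.+1 X Y <-> exists (X0 K : C) (e : hom X0 Y) (k : hom K X0),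
    [/\ in_add X X0, is_epi e, is_kernel e k & gen d X K].
Proof.
split=> [[X_ [f [e [aX ee ex0 ex]]]]|].
  have [K [k kk]] := ab_kernel e.
  have [p ep kp] := exact_image (ex0 isT) kk.
  exists (X_ 0%N), K, e, k; split=> //; first exact: aX.
  exists (fun n => X_ n.+1), (fun n => f n.+1), p; split=> // [n|d0|n].
  - exact: (aX n.+1).
  - by apply/(exact_mono_comp _ _ (kernel_mono kk)); rewrite kp; exact: ex.
  - exact: (ex n.+1).
move=> [X0 [K [e [k [aX0 ee kk [X_ [f [p [aX ep ex0 ex]]]]]]]]].
(* The sequence ending in [K] is spliced with [k], all indices moving up by one. *)
pose X' n := if n is m.+1 then X_ m else X0.
pose f' n : hom (X' n.+1) (X' n) :=
  match n return hom (X' n.+1) (X' n) with 0%N => k \oc p | m.+1 => f m end.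
exists X', f', e; split=> // [[|n]|_|[|n]] //.
- exact: aX.
- exact: exact_kernel_epi kk ep.
- by move=> d0; apply/(exact_mono_comp _ _ (kernel_mono kk)); exact: ex0.
- exact: ex.
Qed.

Lemma gen_fmap (A B : abelianCat) (F : functor A B) d (X Y : A) :
  right_exact F -> acyclic F X -> acyclic F Y -> gen d X Y -> gen d (F X) (F Y).
Proof.
move=> rF aX; elim: d Y => [|d IH] Y aY.
  move=> /gen0E [X0 [e [aX0 ee]]]; apply/gen0E; exists (F X0), (fmap F e).
  by split; [exact: in_add_fmap rF.1 aX0 | exact: right_exact_epi].
move=> /genSE [X0 [K [e [k [aX0 ee kk gK]]]]]; apply/genSE.
exists (F X0), (F K), (fmap F e), (fmap F k); split.
- exact: in_add_fmap rF.1 aX0.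
- exact: right_exact_epi.
- exact: acyclic_kernel_fmap.
- by apply: IH gK; exact: acyclic_kernel kk ee (in_add_acyclic rF aX0 aX) aY.
Qed.

(** * Transport of presentations along the right adjoint *)

Section Adjoint.
Variables (A B : abelianCat) (F : functor A B) (G : functor B A).
Variable adj : adjunction F G.
Let eps := adj_counit adj.

(** The counits identify [F (G e)] with [e], so it is epi; [F] is right exact and therefore sends
    the cokernel of [G e] to zero. Reflection of zero objects enters the proof here. *)
Lemma right_adjoint_epi (Y Z : B) (e : hom Y Z) :
  (forall X : A, is_zero (F X) -> is_zero X) ->
  is_iso (eps Y) -> is_iso (eps Z) -> is_epi e -> is_epi (fmap G e).
Proof.
move=> F0 iY [v [ve ev]] ee; have [Q [q cq]] := ab_cokernel (fmap G e).
apply/(zero_cokernel_epi cq)/F0.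
apply/(zero_cokernel_epi ((left_adjoint_right_exact adj).2 _ _ _ _ _ cq)).
have -> : fmap F (fmap G e) = v \oc (e \oc eps Y).
  by rewrite counit_nat compA ve comp1m.
apply: epi_comp; first exact: section_epi ve.
exact: epi_comp ee (iso_epi iY).
Qed.

(** Invertible counits at [Y] and [Z] identify the two maps of which [k] and [F (G k)] are kernels,
    so the induced map on kernels, the counit at [K], is invertible. *)
Lemma counit_iso_kernel (K Y Z : B) (k : hom K Y) (e : hom Y Z) :
  is_kernel e k -> is_kernel (fmap F (fmap G e)) (fmap F (fmap G k)) ->
  is_iso (eps Y) -> is_iso (eps Z) -> is_iso (eps K).
Proof.
move=> kk kFk [v [ve ev]] iZ.
have [|l kl] := kernel_ex (h := v \oc k) kFk.
  apply: (mono_eq0 (iso_mono iZ)).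
  by rewrite compA -counit_nat -!compA (compA (adj_counit adj Y)) ev comp1m kk.1.
exists l; split.
  apply: (kernel_mono kFk).
  by rewrite compA kl -compA counit_nat compA ve comp1m compm1.
apply: (kernel_mono kk).
by rewrite compA counit_nat -compA kl compA ev comp1m compm1.
Qed.

Lemma gen_right_adjoint d (X : A) (Y : B) :
  (forall X' : A, is_zero (F X') -> is_zero X') ->
  acyclic F X -> is_iso (adj_unit adj X) ->
  is_iso (eps Y) -> acyclic F (G Y) -> gen d (F X) Y -> gen d X (G Y).
Proof.
move=> F0 aX iX.
have rF := left_adjoint_right_exact adj.
have aG := right_adjoint_additive adj.
have iFX : is_iso (eps (F X)).
  exact: iso_retraction (fmap_iso F iX) (triangleF adj X).
have [h iGF] := iso_inv iX.
(* [G] sends summands of powers of [F X] to those of [G (F X)], which the unit identifies with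
   [X]. *)
have addX Y0 : in_add (F X) Y0 -> is_iso (eps Y0) /\ in_add X (G Y0).
  move=> aY0; split; first exact: counit_iso_add rF.1 aG iFX aY0.
  exact: in_add_iso iGF (in_add_fmap aG aY0).
elim: d Y => [|d IH] Y iY aY.
  move=> /gen0E [Y0 [e [/addX [i0 a0] ee]]]; apply/gen0E.
  by exists (G Y0), (fmap G e); split=> //; exact: right_adjoint_epi.
move=> /genSE [Y0 [K [e [k [/addX [i0 a0] ee kk gK]]]]]; apply/genSE.
have eGe := right_adjoint_epi F0 i0 iY ee.
have kGk := right_adjoint_kernel adj kk.
exists (G Y0), (G K), (fmap G e), (fmap G k); split=> //; apply: IH gK.
  exact: counit_iso_kernel kk (acyclic_kernel_fmap rF kGk eGe aY) i0 iY.
exact: acyclic_kernel kGk eGe (in_add_acyclic rF a0 aX) aY.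
Qed.

End Adjoint.

Theorem theorem5p8 (A B : abelianCat)
    (enoughA : enough_projectives A) (enoughB : enough_injectives B)
    (F : functor A B) (G : functor B A) (adj : adjunction F G)
    (F_reflects_zero : forall Y : A, is_zero (F Y) -> is_zero Y)
    (X : A) (hX : Fix0 enoughA enoughB adj X) (d : nat) :
  restricts_to_equivalence adj
    (fun Y : A => Fix0 enoughA enoughB adj Y /\ gen d X Y)
    (fun Y : B => coFix0 enoughA enoughB adj Y /\ gen d (F X) Y).
Proof.
have [aX _ iX] := (Fix0P _ _ _ _).1 hX.
have rF := left_adjoint_right_exact adj.
(* The goals are, in order: [F] preserves the classes, [G] preserves them, and the restricted unit
   and counit are invertible. *)
unshelve eexists; last unshelve eexists.
- move=> Y [/Fix0P [aY cY iY] gY]; split; last exact: gen_fmap.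
  apply/coFix0P; split=> //.
    by move=> n; exact: acyclic_upto_iso iY (aY n).
  (* By the triangle identity the counit at [F Y] is a left inverse of the invertible map [F] of the
     unit. *)
  exact: iso_retraction (fmap_iso F iY) (triangleF adj Y).
- move=> Y [/coFix0P [cY aY iY] gY]; split.
    have [v iv] := iso_inv iY.
    apply/Fix0P; split=> //; first exact: coacyclic_iso iv cY.
    exact: iso_section (fmap_iso G iY) (triangleG adj Y).
  exact: gen_right_adjoint F_reflects_zero aX iX iY aY gY.
split=> -[Y [hY gY]].
  by have [_ _ iY] := (Fix0P _ _ _ _).1 hY.
by have [_ _ iY] := (coFix0P _ _ _ _).1 hY.
Qed.
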